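(* Let $G$ be a finite abelian group, let $\Delta: G \to \widehat{G}$, $y \mapsto \chi_y$, be a group isomorphism, let $N \leqslant G$, and put $\widetilde{N}=\{y \in G \mid \chi_y \text{ is principal on } N\}$. Let $S$ be an $(n,n,n,1)$ relative difference set in $G$ relative to $N$. Then, for a subset $T \subseteq G$, the sets $S$ and $T$ form a primitive formally dual pair in $G$ (under $\Delta$) if and only if $T$ is an $(n,n,n,1)$ relative difference set in $G$ relative to $\widetilde{N}$. More concretely: (1) Let $m\ge 1$, $G=\mathbb{Z}_4^m$ and let $\Delta$ be given by $\chi_y(a)=(\sqrt{-1})^{y\cdot a}$, where $\cdot$ is the usual inner product on $\mathbb{Z}_4^m$. If $S$ and $T$ are two $(2^m,2^m,2^m,1)$ relative difference sets in $\mathbb{Z}_4^m$ relative to $2\mathbb{Z}_4^m$, then $S$ and $T$ form a primitive formally dual pair in $\mathbb{Z}_4^m$. In particular, if $R$ is the Galois ring $\mathrm{GR}(4,m)$ (whose additive group is identified with $\mathbb{Z}_4^m$) and $\mathcal{T}$ is its Teichmüller set, then $S=\mathcal{T}$ and $T=\mathcal{T}$ form a primitive formally dual pair in $\mathbb{Z}_4^m$. (2) Let $p$ be an odd prime, $H=\mathbb{Z}_p^m$ (identified with the additive group of $\mathbb{F}_{p^m}$), $G=H\times H\cong \mathbb{Z}_p^{2m}$, and let $\Delta$ be given by $\chi_{(y_1,y_2)}(a_1,a_2)=\zeta_p^{y_1\cdot a_1+y_2\cdot a_2}$, with $\zeta_p$ a primitive $p$-th root of unity and $\cdot$ the usual inner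 product on $\mathbb{Z}_p^m$. Let $f_1,f_2$ be planar functions from $H$ to $H$. Then $S=\{(x,f_1(x)) \mid x \in H\}$ and $T=\{(f_2(x),x) \mid x \in H\}$ form a primitive formally dual pair in $\mathbb{Z}_p^{2m}$.
   Context: All groups are finite abelian; $\widehat{G}$ is the character group of $G$. Subsets $A\subseteq G$ are identified with elements $\sum_{a\in A}a$ of the group ring $\mathbb{Z}[G]$, $A^{(-1)}=\sum_{a\in A}a^{-1}$, and $\chi(A)=\sum_{a\in A}\chi(a)$. The weight enumerator is $\nu_A(y)=|\{(a_1,a_2)\in A\times A \mid y=a_1a_2^{-1}\}|$. Given an isomorphism $\Delta:G\to\widehat G$, $y\mapsto\chi_y$, subsets $S,T\subseteq G$ form a formally dual pair in $G$ (under $\Delta$) if for every $y\in G$: $|\chi_y(S)|^2=\frac{|S|^2}{|T|}\nu_T(y)$ and $|\chi_y(T)|^2=\frac{|T|^2}{|S|}\nu_S(y)$. A subset of $G$ is primitive if it is not contained in a coset of a proper subgroup of $G$ and is not a union of cosets of a nontrivial subgroup of $G$; a formally dual pair is primitive if both $S$ and $T$ are primitive. For a group $G$ of order $mn$ and a subgroup $N$ of order $n$, a $k$-subset $R\subseteq G$ is an $(m,n,k,\lambda)$ relative difference set relative to $N$ if $RR^{(-1)}=k\cdot 1+\lambda(G-N)$ in $\mathbb{Z}[G]$ (i.e. each element of $G\setminus N$ arises exactly $\lambda$ times as $r_1r_2^{-1}$, $r_1,r_2\in R$, and no nonidentity element of $N$ arises). A function $f:H\to H$ on an abelian group $H$ (written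 additively) is planar if $x\mapsto f(x+a)-f(x)$ is bijective for every nonzero $a\in H$. The Galois ring $\mathrm{GR}(4,m)$ is $\mathbb{Z}_4[x]/(f(x))$ with $f$ monic of degree $m$ whose reduction mod $2$ is irreducible; its Teichmüller set is $\{0\}$ together with the unique cyclic subgroup of order $2^m-1$ of its unit group.
   Formalization: The first equivalence fails for some non-symmetric Δ; for general Δ the right side also requires that {y : χ_y is principal on Ñ} equal N, and the equivalence as written is proved for symmetric Δ (χ_x(y)=χ_y(x)). *)

(* Defs.v *)
From HB Require Import structures.
From mathcomp Require Import all_boot all_order all_algebra all_fingroup.
From mathcomp Require Import all_solvable all_field all_character.

Set Implicit Arguments.
Unset Strict Implicit.
Unset Printing Implicit Defensive.

Import Order.TTheory GRing.Theory Num.Theory.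
Local Open Scope ring_scope.

Section FormalDuality.

Variable gT : finGroupType.
Implicit Types (G K : {group gT}) (A N R S T : {set gT}).

Definition weight_enum A (y : gT) : nat :=
  #|[set u in setX A A | y == (u.1 * u.2^-1)%g]|.

(* The character group of the abelian group G is the set of linear characters
   of G with the pointwise product; the algebraic numbers algC stand for the
   complex numbers. *)
Definition dual_iso G (Delta : gT -> 'CF(G)) : Prop :=
  [/\ {in G, forall y, Delta y \is a linear_char},
      {in G &, forall y z, Delta (y * z)%g = Delta y * Delta z},
      {in G &, injective Delta}
    & forall xi : 'CF(G), xi \is a linear_char ->
        exists2 y, y \in G & Delta y = xi].

Definition char_sum G (xi : 'CF(G)) A : algC := \sum_(a in A) xi a.

(* Since x / 0 = 0 in algC, two empty sets satisfy these equations; an empty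
   set and a nonempty subset of G never do. *)
Definition formally_dual G (Delta : gT -> 'CF(G)) S T : Prop :=
  [/\ S \subset G, T \subset G
    & {in G, forall y,
        `|char_sum (Delta y) S| ^+ 2
          = #|S|%:R ^+ 2 / #|T|%:R * (weight_enum T y)%:R
     /\ `|char_sum (Delta y) T| ^+ 2
          = #|T|%:R ^+ 2 / #|S|%:R * (weight_enum S y)%:R}].

Definition primitive_subset G A : Prop :=
  (forall K, K \proper G -> forall x, x \in G -> ~ A \subset (K :* x)%g)
  /\ (forall K, K \subset G -> K :!=: 1%g ->
        forall P : {set {set gT}}, P \subset rcosets K G -> A <> cover P).

Definition primitive_dual_pair G (Delta : gT -> 'CF(G)) S T : Prop :=
  [/\ formally_dual Delta S T, primitive_subset G S & primitive_subset G T].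

(* The last clause compares the coefficients at y of the two sides of
   R R^(-1) = k 1 + lambda (G - N) in Z[G]. *)
Definition rel_diff_set G N (m n k lambda : nat) R : Prop :=
  [/\ group_set N /\ N \subset G, #|G| = (m * n)%N /\ #|N| = n,
      R \subset G, #|R| = k
    & forall y : gT,
        weight_enum R y = (k * (y == 1%g) + lambda * (y \in G :\: N))%N].

(* The subgroup of the y in G such that Delta y is principal on N. Unless
   Delta is symmetric, i.e. Delta x y = Delta y x, the annihilator of the
   annihilator of N may differ from N; the second equation of formal duality
   then fails for a relative difference set S relative to N and a relative
   difference set T relative to annihilator Delta N. *)
Definition annihilator G (Delta : gT -> 'CF(G)) N : {set gT} :=
  [set y in G | [forall a in N, Delta y a == 1]].

Hypothesis abG : abelian [set: gT].

Lemma fun_is_class_fun (f : gT -> algC) :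
  is_class_fun <<[set: gT]>>%g (finfun f).
Proof.
apply: intro_class_fun => [x y _ _ | x]; last by rewrite mem_gen ?inE.
by rewrite conjgE (centsP abG _ (in_setT y^-1%g) _ (in_setT _)) mulgK.
Qed.

Definition abelian_cfun f : 'CF([set: gT]) := Cfun 0 (fun_is_class_fun f).

Lemma abelian_cfunE f x : abelian_cfun f x = f x.
Proof. by rewrite cfunE. Qed.

End FormalDuality.

Definition dot (R : pzSemiRingType) (n : nat) (y a : 'rV[R]_n) : R :=
  \sum_j y 0 j * a 0 j.

Definition planar (H : zmodType) (f : H -> H) : Prop :=
  forall a : H, a != 0 -> bijective (fun x => f (x + a) - f x).

(* Exponents in 'Z_4 and 'F_p are read through their representatives in nat. *)
Definition Z4_char (m : nat) (y : 'rV['Z_4]_m) : 'CF([set: 'rV['Z_4]_m]) :=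
  abelian_cfun (FinRing.zmod_abelian _) (fun a => 'i ^+ dot y a).

Definition twice_Z4 (m : nat) : {set 'rV['Z_4]_m} := [set a *+ 2 | a : 'rV_m].

Lemma Fp_pair_abelian (p m : nat) :
  abelian [set: 'rV['F_p]_m * 'rV['F_p]_m].
Proof.
apply/centsP => -[x1 x2] _ [y1 y2] _.
by congr (_, _); apply: addrC.
Qed.

Definition Fp_char (p m : nat) (zeta : algC) (y : 'rV['F_p]_m * 'rV['F_p]_m) :
    'CF([set: 'rV['F_p]_m * 'rV['F_p]_m]) :=
  abelian_cfun (Fp_pair_abelian p m)
    (fun a => zeta ^+ (dot y.1 a.1 + dot y.2 a.2)%R).

Definition galois_poly (m : nat) (f : {poly 'Z_4}) : Prop :=
  [/\ f \is monic, size f = m.+1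
    & irreducible_poly (map_poly (fun c : 'Z_4 => (c : nat)%:R : 'F_2) f)].

Definition galois_ring (f : {poly 'Z_4}) : Type := {poly %/ f}.

HB.instance Definition _ f := GRing.ComNzRing.on (galois_ring f).
HB.instance Definition _ f := Finite.on (galois_ring f).
HB.instance Definition _ f := FinRing.isNzRing.Build (galois_ring f).

(* The union runs over the cyclic subgroups of order 2 ^ m - 1 of the unit
   group; in a Galois ring there is exactly one of them. *)
Definition teichmuller (m : nat) (f : {poly 'Z_4}) : {set galois_ring f} :=
  0 |: \bigcup_(C : {group {unit galois_ring f}}
                 | cyclic C && (#|C| == 2 ^ m - 1)%N) [set val u | u in C].

(* Main.v *)
(* Let S be an (n,n,n,1) relative difference set relative to N.  Applying a
   character chi to S S^(-1) = n + (G - N) and using orthogonality, |chi(S)|^2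
   is n^2 at the principal character, 0 at the other characters principal on N,
   and n elsewhere: this is n times the weight enumerator of an (n,n,n,1)
   relative difference set relative to the annihilator of N.  Conversely formal
   duality prescribes nu_T up to the factor |T| / n, and summing nu_T over G
   gives |T| = n.  Primitivity holds because a proper subgroup is too small to
   contain G - N, while a union of cosets of K has large weight at K.

   In the Galois ring, reduction modulo 2 onto the residue field restricts to a
   bijection on the Teichmueller set, since r = s mod 2 implies r^2 = s^2. *)

From HB Require Import structures.
Require Import Defs.
From mathcomp Require Import all_boot all_order all_algebra all_fingroup.
From mathcomp Require Import all_solvable all_field all_character.
From mathcomp Require Import zify ring.

Set Implicit Arguments.
Unset Strict Implicit.
Unset Printing Implicit Defensive.

Import Order.TTheory GRing.Theory Num.Theory.
Local Open Scope ring_scope.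

(** * Relative difference sets and formal duality *)

Section WeightEnumerator.

Variable gT : finGroupType.
Implicit Types (G K N : {group gT}) (A M R S T : {set gT}).

Lemma sum_weight_enum (V : nmodType) G A (F : gT -> V) :
    A \subset G ->
  \sum_(a in A) \sum_(b in A) F (a * b^-1)%g
    = \sum_(y in G) F y *+ weight_enum A y.
Proof.
move=> sAG; rewrite pair_big /=.
rewrite (partition_big (fun u : gT * gT => (u.1 * u.2^-1)%g) [in G]) /=; last first.
  by move=> u /andP[u1 u2]; rewrite groupM ?groupV ?(subsetP sAG).
apply: eq_bigr => y _; rewrite -sumr_const; apply: congr_big => //= u.
  by rewrite !inE eq_sym.
by case/andP=> _ /eqP ->.
Qed.

Lemma weight_enum1 A : weight_enum A 1%g = #|A|.
Proof.
rewrite -(card_imset (mem A) (f := fun a => (a, a))); last by move=> a b [].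
apply: eq_card => -[a b]; rewrite !inE /=; apply/andP/imsetP => [[/andP[Aa Ab]]|].
  by rewrite eq_sym -eq_mulgV1 => /eqP<-; exists a.
by case=> c Ac [-> ->]; rewrite Ac mulgV eqxx.
Qed.

Lemma weight_enum_out G A y :
  A \subset G -> y \notin G -> weight_enum A y = 0%N.
Proof.
move=> sAG; apply: contraNeq; rewrite -lt0n => /card_gt0P[u].
rewrite !inE => /andP[/andP[Au1 Au2] /eqP ->].
by rewrite groupM ?groupV ?(subsetP sAG).
Qed.

Lemma sum_weight_enum1 G A :
  A \subset G -> (\sum_(y in G) weight_enum A y = #|A| ^ 2)%N.
Proof.
move=> sAG; have -> : (#|A| ^ 2)%N = \sum_(a in A) \sum_(b in A) 1%N.
  by rewrite !sum_nat_const muln1.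
rewrite (sum_weight_enum (fun=> 1%N) sAG); apply: eq_bigr => y _.
by rewrite -[RHS]/(1%R *+ _) natn.
Qed.

(** This is the identity [R R^(-1) = k + lambda (G - N)] with [F] extended linearly to the group
    ring. *)
Lemma sum_rds (V : zmodType) G N R m n k lambda (F : gT -> V) :
    rel_diff_set G N m n k lambda R ->
  \sum_(a in R) \sum_(b in R) F (a * b^-1)%g
    = F 1%g *+ k + (\sum_(y in G) F y - \sum_(y in N) F y) *+ lambda.
Proof.
case=> -[_ sNG] _ sRG _ nuR; rewrite (sum_weight_enum _ sRG).
under eq_bigr do rewrite nuR mulrnDr !mulrnA.
rewrite big_split /=; congr (_ + _).
  rewrite (bigD1 1%g) //= eqxx mulr1n big1 ?addr0 // => y /andP[_ /negPf ->].
  by rewrite mulr0n.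
have -> : \sum_(y in N) F y = \sum_(y in G | y \in N) F y.
  by apply: eq_bigl => y; case: (boolP (y \in N)) => [/(subsetP sNG)->|]; rewrite ?andbF.
rewrite [\sum_(y in G) F y](bigID [in N]) /= addrAC subrr add0r -sumrMnl.
rewrite [RHS]big_mkcondr /=; apply: eq_bigr => y Gy; rewrite inE Gy andbT.
by case: (y \in N); rewrite /= ?mulr1n.
Qed.

End WeightEnumerator.

(** Orthogonality: if [f a != 1], translating the summation variable by [a] multiplies the sum by
    [f a], so the sum vanishes in an integral domain. It serves for characters on a subgroup and for
    the evaluations of all [Delta y] at a fixed point. *)
Lemma sum_mult_morph (gT : finGroupType) (R : idomainType) (K : {group gT})
    (f : gT -> R) :
    {in K &, {morph f : x y / (x * y)%g >-> x * y}} ->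
  \sum_(a in K) f a = (#|K| * [forall a in K, f a == 1])%:R.
Proof.
move=> fM; case: (boolP [forall a in K, f a == 1]) => [/forall_inP f1 | ].
  by rewrite muln1 -sumr_const; apply: eq_bigr => a /f1/eqP.
rewrite negb_forall_in muln0 => /exists_inP[a Ka fa1].
have: f a * \sum_(b in K) f b = \sum_(b in K) f b.
  rewrite mulr_sumr [RHS](reindex_inj (mulgI a)) /=.
  by apply: eq_big => [b | b Kb]; rewrite ?groupMl ?fM.
move/eqP; rewrite -subr_eq0 -[X in _ - X]mul1r -mulrBl mulf_eq0 subr_eq0.
by rewrite (negPf fa1) => /eqP.
Qed.

(** * Annihilators, character sums and formal duality *)

Section Duality.

Variables (gT : finGroupType) (G : {group gT}) (Delta : gT -> 'CF(G)).
Hypotheses (abG : abelian G) (dualD : dual_iso Delta).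
Implicit Types (K N : {group gT}) (M R S T : {set gT}).

Let lin_Delta : {in G, forall y, Delta y \is a linear_char}.
Proof. by case: dualD. Qed.

Let DeltaM : {in G &, forall y z, Delta (y * z)%g = Delta y * Delta z}.
Proof. by case: dualD. Qed.

Lemma norm_char_sum (xi : 'CF(G)) R :
    xi \is a linear_char -> R \subset G ->
  `|char_sum xi R| ^+ 2 = \sum_(a in R) \sum_(b in R) xi (a * b^-1)%g.
Proof.
move=> lin_xi /subsetP sRG; rewrite normCK /char_sum rmorph_sum mulr_suml.
apply: eq_bigr => a Ra; rewrite mulr_sumr; apply: eq_bigr => b Rb.
by rewrite lin_charM ?groupV ?sRG // lin_charV_conj ?sRG.
Qed.

Lemma dual_iso1 : Delta 1%g = 1.
Proof.
have [_ _ _ /(_ 1 (cfun1_lin_char G))[y Gy Dy]] := dualD.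
by rewrite -[LHS]mul1r -Dy -DeltaM ?group1 // mulg1.
Qed.

(** By surjectivity of [Delta] the left side puts [a] in the kernel of every irreducible character,
    and these kernels intersect trivially. *)
Lemma dual_sep a : a \in G -> [forall y in G, Delta y a == 1] = (a == 1%g).
Proof.
move=> Ga; apply/forall_inP/eqP => [D1 | -> y Gy]; last first.
  by rewrite lin_char1 ?lin_Delta.
apply/set1gP; rewrite -(TI_cfker_irr G); apply/bigcapP => i _.
have lin_i : 'chi_i \is a linear_char by apply/char_abelianP.
have [_ _ _ /(_ _ lin_i)[y Gy <-]] := dualD.
by rewrite cfkerEchar ?lin_charW ?lin_Delta // inE Ga lin_char1 ?lin_Delta ?D1.
Qed.

Lemma group_set_annihilator M : M \subset G -> group_set (annihilator Delta M).
Proof.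
move=> /subsetP sMG; apply/group_setP; split=> [|y z].
  rewrite inE group1 /=; apply/forall_inP => a Ma.
  by rewrite dual_iso1 cfun1E sMG.
rewrite !inE => /andP[Gy /forall_inP y1] /andP[Gz /forall_inP z1].
rewrite groupM //=; apply/forall_inP => a Ma.
by rewrite DeltaM // cfunE (eqP (y1 a Ma)) (eqP (z1 a Ma)) mulr1.
Qed.

Lemma annihilator_sub M : annihilator Delta M \subset G.
Proof. by apply/subsetP => y; rewrite inE => /andP[]. Qed.

(** Double counting of the sum of [Delta y a]: summing over [y] in [G] first leaves only [a = 1],
    summing over [a] in [N] first leaves only the [y] in the annihilator. *)
Lemma card_annihilator N : N \subset G ->
  (#|annihilator Delta N| * #|N| = #|G|)%N.
Proof.
move=> sNG; apply/eqP; rewrite -(eqr_nat algC); apply/eqP.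
have <-: \sum_(y in G) \sum_(a in N) Delta y a = #|G|%:R.
  rewrite exchange_big /= (bigD1 1%g) //= (eq_bigr (fun=> 1)) => [|y Gy].
    rewrite sumr_const big1 ?addr0 // => a /andP[Na a1].
    rewrite (@sum_mult_morph _ _ _ (fun y => Delta y a)) => [|y z Gy Gz].
      by rewrite dual_sep ?(subsetP sNG) // (negPf a1) muln0.
    by rewrite DeltaM // cfunE.
  by rewrite lin_char1 ?lin_Delta.
rewrite natrM mulr_natl -sumr_const.
rewrite [RHS](bigID [in annihilator Delta N]) /= [X in _ + X]big1 => [|y].
  rewrite addr0; apply: eq_big => [y | y]; rewrite inE.
    by case: (y \in G).
  case/andP=> Gy /forall_inP y1; rewrite -sumr_const; apply: eq_bigr => a Na.
  by rewrite (eqP (y1 a Na)).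
case/andP=> Gy; rewrite inE Gy /= => /negPf y1.
rewrite sum_mult_morph => [|a b Na Nb]; first by rewrite y1 muln0.
by rewrite lin_charM ?(subsetP sNG) ?lin_Delta.
Qed.

Lemma norm_char_sum_rds N n R y :
    rel_diff_set G N n n n 1 R -> y \in G ->
  `|char_sum (Delta y) R| ^+ 2
    = (n * (n * (y == 1%g) + (y \in G :\: annihilator Delta N)))%:R.
Proof.
move=> rdsR Gy; have lin_y := lin_Delta Gy.
have [[_ sNG] [oG oN] sRG _ _] := rdsR.
have yM (H : {set gT}) : H \subset G -> {in H &, {morph Delta y : a b / (a * b)%g >-> a * b}}.
  by move=> /subsetP sHG a b Ha Hb; rewrite lin_charM ?sHG.
rewrite norm_char_sum // (sum_rds _ rdsR) lin_char1 // mulr1n.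
rewrite !sum_mult_morph; last 2 first.
- exact: yM.
- exact: yM.
have -> : [forall a in G, Delta y a == 1] = (y == 1%g).
  apply/forall_inP/eqP => [y1 | -> a Ga]; last by rewrite dual_iso1 cfun1E Ga.
  case: dualD => _ _ injD _; apply: injD; rewrite ?group1 // dual_iso1.
  by apply/cfun_inP => a Ga; rewrite cfun1E Ga (eqP (y1 a Ga)).
rewrite inE Gy andbT oG oN inE Gy /=.
(* The principal character gives [n + (n^2 - n)], the others give [n - n] if principal on [N] and
   [n] if not. *)
case: eqVneq => [-> | _].
  have -> : [forall a in N, Delta 1%g a == 1].
    by apply/forall_inP => a Na; rewrite dual_iso1 cfun1E (subsetP sNG).
  by rewrite !muln1 addn0 addrC subrK.
rewrite !muln0 sub0r; case: [forall a in N, _]; first by rewrite !muln1 subrr muln0.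
by rewrite !muln0 !muln1 subr0.
Qed.

(** Each annihilator hypothesis serves one equation: the character sums of [S] see the annihilator
    of [N], those of [T] the annihilator of [M]. *)
Lemma rds_formally_dual N M n S T :
    rel_diff_set G N n n n 1 S -> rel_diff_set G M n n n 1 T ->
    annihilator Delta N = M -> annihilator Delta M = N ->
  formally_dual Delta S T.
Proof.
move=> rdsS rdsT annN annM.
have [[gM sMG] [oG _] sTG oT nuT] := rdsT; have [_ _ sSG oS nuS] := rdsS.
split=> // y Gy; have n0 : (n%:R : algC) != 0.
  by rewrite pnatr_eq0; apply: contraTneq (cardG_gt0 G) => n0; rewrite oG n0.
rewrite (norm_char_sum_rds rdsS Gy) (@norm_char_sum_rds (Group gM) _ _ _ rdsT Gy) /=.
rewrite annN annM nuS nuT oS oT !mul1n expr2 mulfK //.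
by rewrite -!natrM.
Qed.

(** The first equation of duality makes [T] a relative difference set; the second, evaluated for
    this [T], forces the double annihilator of [N] to be [N]. *)
Lemma formally_dual_rds N n S T :
    N \subset G -> rel_diff_set G N n n n 1 S -> formally_dual Delta S T ->
  rel_diff_set G (annihilator Delta N) n n n 1 T
  /\ annihilator Delta (annihilator Delta N) = N.
Proof.
move=> sNG rdsS [_ sTG dualST].
have [_ [oG oN] sSG oS nuS] := rdsS.
have n_gt0 : (0 < n)%N by rewrite -oN.
have n0 : (n%:R : algC) != 0 by rewrite pnatr_eq0 -lt0n.
have oA : #|annihilator Delta N| = n.
  by apply/eqP; rewrite -(eqn_pmul2r n_gt0) -[X in (_ * X)%N]oN card_annihilator ?oG.
(* For empty [T] the convention [x / 0 = 0] would make the right side vanish at [y = 1], where the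
   left side is positive. *)
have T0 : #|T| != 0%N.
  apply: contraTneq n_gt0 => T0; have [] := dualST _ (group1 G).
  rewrite (norm_char_sum_rds rdsS (group1 G)) T0 invr0 mulr0 mul0r eqxx => /eqP.
  by rewrite pnatr_eq0 !muln_eq0 addn_eq0 muln1; case: (n).
have nuT y : y \in G ->
    (n * weight_enum T y
      = #|T| * (n * (y == 1%g) + (y \in G :\: annihilator Delta N)))%N.
  move=> Gy; have [E _] := dualST _ Gy; move: E.
  rewrite (norm_char_sum_rds rdsS Gy) oS.
  set c := (_ + _)%N; rewrite natrM => E.
  apply/eqP; rewrite -(eqr_nat algC) !natrM; apply/eqP/(mulfI n0).
  rewrite [RHS]mulrCA E; field.
  by rewrite pnatr_eq0.
have nuT1 y : y \in G -> y != 1%g ->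
    (n * weight_enum T y = #|T| * (y \in G :\: annihilator Delta N))%N.
  by move=> Gy /negPf y1; rewrite nuT // y1 muln0.
have A1 : 1%g \in annihilator Delta N.
  by case/group_setP: (group_set_annihilator sNG).
(* Summing [nuT] over [G] gives [n |T|^2 = |T| (n + (n^2 - n))]. *)
have oT : #|T| = n.
  have := sum_weight_enum1 sTG => /(congr1 (muln n)); rewrite big_distrr /=.
  rewrite (eq_bigr _ nuT) -big_distrr big_split /= (bigD1 1%g) //= eqxx.
  rewrite big1 => [|y /andP[_ /negPf->]]; last by rewrite muln0.
  have -> : (\sum_(y in G) (y \in G :\: annihilator Delta N)
             = #|G :\: annihilator Delta N|)%N.
    rewrite -sum1_card [LHS]big_mkcond [RHS]big_mkcond.
    by apply: eq_bigr => y _; rewrite inE andbC; do 2 case: (y \in _).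
  rewrite cardsD (setIidPr (annihilator_sub N)) oA oG addn0 muln1.
  rewrite subnKC ?leq_pmulr // -mulnn [in RHS]mulnCA => /eqP.
  by rewrite eqn_pmul2l ?lt0n // eqn_pmul2l // eq_sym => /eqP.
have nuTE y : weight_enum T y
    = (n * (y == 1%g) + 1 * (y \in G :\: annihilator Delta N))%N.
  have [Gy | nGy] := boolP (y \in G); last first.
    rewrite (weight_enum_out sTG nGy) inE (negPf nGy) andbF.
    by case: eqP nGy => [->|]; rewrite ?group1 ?muln0.
  apply/eqP; rewrite -(eqn_pmul2l n_gt0) nuT // oT mul1n.
  by [].
have rdsT : rel_diff_set G (annihilator Delta N) n n n 1 T.
  split; rewrite ?annihilator_sub ?group_set_annihilator //.
split=> //; apply/setP => y.
have [Gy | nGy] := boolP (y \in G); last first.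
  by rewrite inE (negPf nGy); apply/esym/negbTE; apply: contra nGy; apply: (subsetP sNG).
have [-> | y1] := eqVneq y 1%g.
  by rewrite group1; case/group_setP: (group_set_annihilator (annihilator_sub N)).
(* Away from 1 the two sides are [n] times the indicators of the complements of the double
   annihilator and of [N]. *)
have [_ E] := dualST _ Gy; move: E.
rewrite (@norm_char_sum_rds (Group (group_set_annihilator sNG)) _ _ _ rdsT Gy).
rewrite nuS oT oS (negPf y1) !muln0 !add0n mul1n expr2 mulfK // -natrM => /eqP.
rewrite eqr_nat eqn_pmul2l // !in_setD Gy !andbT /=.
by do 2 case: (y \in _).
Qed.

End Duality.

Lemma rds_primitive (gT : finGroupType) (G N : {group gT}) n (R : {set gT}) :
  rel_diff_set G N n n n 1 R -> primitive_subset G R.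
Proof.
case=> -[_ sNG] [oG oN] sRG oR nuR.
have n_gt0 : (0 < n)%N by rewrite -oN.
split=> [K /andP[sKG nKG] x Gx /subsetP sRK | K sKG K1 P sPK defR].
  (* Quotients of elements of one coset of [K] lie in [K], and every element of [G :\: N] is such a
     quotient. *)
  have sDK : G :\: N \subset K :\ 1%g.
    apply/subsetP => y GNy; have := nuR y; rewrite GNy !inE.
    have -> : (y == 1%g) = false.
      by apply: contraTF GNy => /eqP ->; rewrite inE group1.
    rewrite muln0 => /eqP; rewrite eqn_leq => /andP[_ /card_gt0P[[a b]]].
    rewrite !inE /= => /andP[/andP[/sRK Ra /sRK Rb] /eqP ->].
    have [k Kk ->] := rcosetP Ra; have [l Kl ->] := rcosetP Rb.
    by rewrite invMg mulgA mulgK groupM ?groupV.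
  (* Hence n^2 - n + 1 <= #|K|, whereas 2 #|K| <= n^2. *)
  have := subset_leq_card sDK; rewrite cardsD (setIidPr sNG) oG oN.
  have := cardsD1 1%g K; rewrite group1 => oK.
  have := Lagrange sKG; have : (1 < #|G : K|%g)%N by rewrite indexg_gt1.
  rewrite oG; move: #|G : K|%g #|K :\ 1%g| #|K| oK => q k' k -> q1 E.
  rewrite leq_subLR => le_nk; move: E.
  have : (1 + k' <= (1 + k') * (q - 1))%N by rewrite leq_pmulr // subn_gt0.
  rewrite mulnBr muln1 leq_subRL ?leq_pmulr ?(ltnW q1) //.
  clear -le_nk => lekq E.
  have {lekq E} : (1 + k' + (1 + k') <= n * n)%N by rewrite -E.
  (* The two bounds together would give [(n - 1)^2 + 1 <= 0]. *)
  nia.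
have [a Ra] : exists a, a \in R by apply/card_gt0P; rewrite oR.
have [k Kk k1] := trivgPn _ K1.
have RK b : b \in R -> (k * b)%g \in R.
  rewrite defR => /bigcupP[B PB Bb]; apply/bigcupP; exists B => //.
  have /rcosetsP[x Gx defB] := subsetP sPK _ PB.
  by move: Bb; rewrite defB !mem_rcoset -mulgA; apply: groupM.
(* Each pair [(k b, b)] represents [k], which has weight at most 1; so [n = 1] and [G] is trivial,
   contradicting the choice of [K]. *)
have: (#|R| <= weight_enum R k)%N.
  rewrite -(card_imset (mem R) (f := fun b => ((k * b)%g, b))); last by move=> ? ? [].
  apply: subset_leq_card; apply/subsetP => _ /imsetP[b Rb ->].
  by rewrite !inE /= RK // mulgK eqxx; rewrite Rb.
rewrite nuR (negPf k1) muln0 add0n mul1n oR => n1.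
have oG1 : #|G| = 1%N by rewrite oG; have := leq_trans n1 (leq_b1 _); case: (n) n_gt0 => [|[]].
by move/negP: K1; apply; rewrite -subG1 (subset_trans sKG) // -(card1_trivg oG1).
Qed.

(** * Characters defined by pairings *)

(** An abelian group has [#|G|] irreducible characters, so an injective map from [G] to linear
    characters is onto. *)
Lemma dual_isoI (gT : finGroupType) (G : {group gT}) (Delta : gT -> 'CF(G)) :
    abelian G ->
    {in G, forall y, Delta y \is a linear_char} ->
    {in G &, forall y z, Delta (y * z)%g = Delta y * Delta z} ->
    {in G &, injective Delta} ->
  dual_iso Delta.
Proof.
move=> abG linD DM injD; split=> // xi lin_xi.
have linE y : y \in G -> 'chi_(cfIirr (Delta y)) = Delta y.
  by move=> Gy; rewrite cfIirrE ?lin_char_irr ?linD.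
have /setP onto : [set cfIirr (Delta y) | y in G] = setT.
  apply/eqP; rewrite eqEcard subsetT cardsT card_in_imset => [|y z Gy Gz E].
    by move: abG; rewrite /= card_ord NirrE card_classes_abelian => /eqP->.
  by have := linE z Gz; rewrite -E linE //; apply: injD.
have /imsetP[y Gy E] : cfIirr xi \in [set cfIirr (Delta y) | y in G].
  by rewrite onto inE.
by exists y => //; rewrite -linE // -E cfIirrE ?lin_char_irr.
Qed.

Lemma mult_morph_lin_char (gT : finGroupType) (G : {group gT}) (xi : 'CF(G)) :
  xi 1%g = 1 -> {in G &, {morph xi : x y / (x * y)%g >-> x * y}} ->
  xi \is a linear_char.
Proof.
move=> xi1 xiM; have rP : mx_repr G (fun x => (xi x)%:M : 'M[algC]_1).
  by split=> [|x y Gx Gy]; rewrite ?xi1 // xiM // scalar_mxM.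
suff -> : xi = cfRepr (MxRepresentation rP).
  by rewrite qualifE /= cfRepr_char cfRepr1 eqxx.
by apply/cfun_inP => x Gx; rewrite cfunE Gx /= mxtrace_scalar.
Qed.

Section PairingCharacters.

Variables (gT : finGroupType) (n : nat) (zeta : algC) (B : gT -> gT -> 'I_n.+2).
Hypothesis abT : abelian [set: gT].
Hypothesis zetaP : n.+2.-primitive_root zeta.
Hypothesis B_Dr : forall y a b, B y (a * b)%g = B y a + B y b.
Hypothesis B_Dl : forall y z a, B (y * z)%g a = B y a + B z a.
Hypothesis B_inj : forall y z, (forall a, B y a = B z a) -> y = z.
Variable Delta : gT -> 'CF([set: gT]).
Hypothesis DeltaE : forall y a, Delta y a = zeta ^+ B y a.

Let zetaD (k l : 'I_n.+2) : zeta ^+ (k + l)%R = zeta ^+ k * zeta ^+ l.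
Proof. by rewrite -exprD /= prim_expr_mod. Qed.

Let zeta_inj (k l : 'I_n.+2) : zeta ^+ k = zeta ^+ l -> k = l.
Proof.
move/eqP; rewrite (eq_prim_root_expr zetaP) !modn_small ?ltn_ord // => /eqP.
exact: val_inj.
Qed.

(** ['Z_4] and ['F_p] both unfold to some ['I_n.+2] with addition modulo [n.+2], so one argument on
    nondegenerate biadditive pairings covers both families of characters. *)
Lemma pairing_dual_iso : dual_iso (G := [set: gT]%G) Delta.
Proof.
apply: dual_isoI => // [y _|y z _ _|y z _ _ eqD].
- apply: mult_morph_lin_char => [|a b _ _]; last by rewrite !DeltaE B_Dr zetaD.
  have := B_Dr y 1%g 1%g; rewrite mulg1 => /esym/eqP.
  by rewrite -subr_eq0 addrK DeltaE => /eqP ->.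
- by apply/cfunP => a; rewrite cfunE !DeltaE B_Dl zetaD.
- by apply: B_inj => a; apply: zeta_inj; rewrite -!DeltaE eqD.
Qed.

Lemma pairing_eq1 y a : (Delta y a == 1) = (B y a == 0).
Proof.
rewrite DeltaE -[1](expr0 zeta); apply/eqP/eqP => [|-> //].
exact: (@zeta_inj _ 0).
Qed.

End PairingCharacters.

Lemma prim_root_i : 4.-primitive_root ('i : algC).
Proof.
have i2 : 'i ^+ 2 = -1 :> algC by exact: sqrCi.
have n11 : (-1 == 1 :> algC) = false by rewrite -subr_eq0 -opprD oppr_eq0 (pnatr_eq0 _ 2).
have i1 : ('i == 1 :> algC) = false.
  by apply/eqP => i1; move: n11; rewrite -i2 i1 expr1n eqxx.
have i3 : ('i ^+ 3 == 1 :> algC) = false.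
  rewrite exprS i2 mulrN1; apply/eqP => i1'; move: n11.
  by rewrite -i2 -sqrrN i1' expr1n eqxx.
apply/andP; split=> //; apply/forallP => -[[|[|[|[|]]]] lt4] //=.
- by rewrite unity_rootE expr1 i1.
- by rewrite unity_rootE i2 n11.
- by rewrite unity_rootE i3.
- by rewrite unity_rootE (exprM _ 2 2) i2 sqrrN expr1n !eqxx.
Qed.

Lemma dotDl (R : pzRingType) n (y z a : 'rV[R]_n) :
  dot (y + z) a = dot y a + dot z a.
Proof. by rewrite -big_split; apply: eq_bigr => j _; rewrite mxE mulrDl. Qed.

Lemma dotDr (R : pzRingType) n (y a b : 'rV[R]_n) :
  dot y (a + b) = dot y a + dot y b.
Proof. by rewrite -big_split; apply: eq_bigr => j _; rewrite mxE mulrDr. Qed.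

Lemma dot_delta (R : pzRingType) n (y : 'rV[R]_n) j :
  dot y (delta_mx 0 j) = y 0 j.
Proof.
rewrite /dot (bigD1 j) //= mxE !eqxx mulr1 big1 ?addr0 // => i /negPf ij.
by rewrite mxE ij andbF mulr0.
Qed.

Lemma dot_inj (R : pzRingType) n (y z : 'rV[R]_n) :
  (forall a, dot y a = dot z a) -> y = z.
Proof. by move=> E; apply/rowP => j; rewrite -!dot_delta E. Qed.

Lemma Z4_char_dual_iso m : dual_iso (G := [set: 'rV['Z_4]_m]%G) (@Z4_char m).
Proof.
apply: (pairing_dual_iso (B := @dot 'Z_4 m) _ prim_root_i).
- exact: FinRing.zmod_abelian.
- exact: dotDr.
- exact: dotDl.
- exact: dot_inj.
- by move=> y a; rewrite abelian_cfunE.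
Qed.

Lemma dot0l (R : pzRingType) n (a : 'rV[R]_n) : dot 0 a = 0.
Proof. by rewrite /dot big1 // => j _; rewrite mxE mul0r. Qed.

Lemma dot0r (R : pzRingType) n (a : 'rV[R]_n) : dot a 0 = 0.
Proof. by rewrite /dot big1 // => j _; rewrite mxE mulr0. Qed.

Lemma twice_Z4E m (y : 'rV['Z_4]_m) : (y \in twice_Z4 m) = (y *+ 2 == 0).
Proof.
apply/imsetP/eqP => [[a _ ->] | y2].
  by rewrite -mulrnA -scaler_nat (_ : _%:R = 0) ?scale0r //; apply: val_inj.
(* An entry killed by doubling is 0 or 2, and doubling half of its representative gives it back. *)
exists (\row_j ((y 0 j : nat)./2)%:R) => //; apply/rowP => j.
move/rowP/(_ j): y2; rewrite -!scaler_nat !mxE.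
by case: (y 0 j) => [[|[|[|[|]]]]] //= lt4 /(congr1 val) // _; apply: val_inj.
Qed.

(** Since [y . 2a = 2y . a] and the pairing is nondegenerate, the annihilator of the image of
    doubling is the kernel of doubling, which in [Z_4^m] is that same image. *)
Lemma annihilator_twice_Z4 m :
  annihilator (G := [set: 'rV['Z_4]_m]%G) (@Z4_char m) (twice_Z4 m)
    = twice_Z4 m.
Proof.
apply/setP => y; rewrite inE in_setT twice_Z4E /=.
have E a : (Z4_char y a == 1) = (dot y a == 0).
  apply: (pairing_eq1 (B := @dot 'Z_4 m) prim_root_i) => {}y {}a.
  by rewrite abelian_cfunE.
have dot2 a : dot y (a *+ 2) = dot (y *+ 2) a.
  by rewrite !mulr2n dotDr dotDl.
apply/forall_inP/eqP => [y1 | y2 _ /imsetP[a _ ->]]; last first.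
  by rewrite E dot2 y2 dot0l.
apply: dot_inj => a; rewrite dot0l -dot2; apply/eqP; rewrite -E.
by apply: y1; apply: imset_f.
Qed.

Lemma Fp_char_dual_iso p m zeta : prime p -> p.-primitive_root zeta ->
  dual_iso (G := [set: 'rV['F_p]_m * 'rV['F_p]_m]%G) (@Fp_char p m zeta).
Proof.
(* The order of [zeta] is put in the form [n.+2] under which ['F_p] is an ordinal type. *)
move=> p_pr; rewrite -{1}(Fp_cast p_pr) => zetaP.
apply: (pairing_dual_iso (B := fun y a => dot y.1 a.1 + dot y.2 a.2) _ zetaP).
- exact: Fp_pair_abelian.
- by move=> y a b; rewrite !dotDr addrACA.
- by move=> y z a; rewrite !dotDl addrACA.
- move=> y z E; rewrite [y]surjective_pairing [z]surjective_pairing.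
  congr (_, _); apply: dot_inj => a.
    by have := E (a, 0); rewrite /= !dot0r !addr0.
  by have := E (0, a); rewrite /= !dot0r !add0r.
- by move=> y a; rewrite abelian_cfunE.
Qed.

(** * The equivalence, and criteria for relative difference sets *)

Lemma rds_dual_iff (gT : finGroupType) (G N : {group gT})
    (Delta : gT -> 'CF(G)) n (S T : {set gT}) :
    abelian G -> dual_iso Delta -> N \subset G ->
    rel_diff_set G N n n n 1 S ->
  (primitive_dual_pair Delta S T <->
   rel_diff_set G (annihilator Delta N) n n n 1 T
   /\ annihilator Delta (annihilator Delta N) = N).
Proof.
move=> abG dualD sNG rdsS; split=> [[fd _ _] | [rdsT annN]].
  exact: formally_dual_rds rdsS fd.
split; last 2 first.
- exact: rds_primitive rdsS.
- exact: (@rds_primitive _ G (Group (group_set_annihilator dualD sNG)) _ _ rdsT).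
exact: rds_formally_dual rdsS rdsT _ annN.
Qed.

(** Symmetry puts [N] inside its double annihilator, and applying [card_annihilator] twice shows
    that the orders agree. *)
Lemma annihilatorK_sym (gT : finGroupType) (G N : {group gT})
    (Delta : gT -> 'CF(G)) :
    abelian G -> dual_iso Delta -> N \subset G ->
    {in G &, forall x y, Delta x y = Delta y x} ->
  annihilator Delta (annihilator Delta N) = N.
Proof.
move=> abG dualD sNG symD; pose A := Group (group_set_annihilator dualD sNG).
have sAG : A \subset G by apply: annihilator_sub.
apply/esym/eqP; rewrite eqEcard; apply/andP; split.
  apply/subsetP => a Na; have Ga := subsetP sNG a Na.
  rewrite inE Ga; apply/forall_inP => y; rewrite inE => /andP[Gy /forall_inP y1].
  by rewrite symD ?y1.
have := card_annihilator abG dualD sAG; rewrite -(card_annihilator abG dualD sNG).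
by rewrite mulnC => /eqP; rewrite eqn_pmul2l ?(cardG_gt0 A) // => /eqP ->.
Qed.

(* R has n^2 - n ordered pairs of distinct elements, so injectivity of the
   difference map on them makes it a bijection onto G :\: N. *)
Lemma rdsI (gT : finGroupType) (G N : {group gT}) n (R : {set gT}) :
    N \subset G -> #|G| = (n * n)%N -> #|N| = n -> R \subset G -> #|R| = n ->
    {in R &, forall a b, a * b^-1 \in N -> a = b}%g ->
    (forall a b c d, a \in R -> b \in R -> c \in R -> d \in R ->
       a != b -> a * b^-1 = c * d^-1 -> a = c)%g ->
  rel_diff_set G N n n n 1 R.
Proof.
move=> sNG oG oN sRG oR RN Rinj; split=> //; first by rewrite groupP.
pose D := [set u in setX R R | u.1 != u.2].
pose q (u : gT * gT) := (u.1 * u.2^-1)%g.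
have oD : #|D| = #|G :\: N|.
  have -> : D = setX R R :\: [set (a, a) | a in R].
    apply/setP => -[a b]; rewrite !inE /= andbC.
    case: (boolP ((a \in R) && (b \in R))) => [/andP[Ra Rb]|].
      congr (~~ _ && _); apply/eqP/imsetP => [->|[c _ [-> ->]]] //.
      by exists b.
    by rewrite !andbF.
  rewrite !cardsD (setIidPr _); last first.
    by apply/subsetP => _ /imsetP[a Ra ->]; rewrite inE /= Ra.
  rewrite card_imset => [|a b [] //]; rewrite cardsX oR.
  by rewrite (setIidPr sNG) oG oN.
have injq : {in D &, injective q}.
  move=> [a b] [c d]; rewrite !inE /= => /andP[/andP[Ra Rb] ab] /andP[/andP[Rc Rd] _].
  rewrite /q /= => E; have ac : a = c by apply: Rinj E.
  by move: E; rewrite ac => /mulgI/invg_inj ->.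
have qD : q @: D = G :\: N.
  apply/eqP; rewrite eqEcard card_in_imset // oD leqnn andbT.
  apply/subsetP => _ /imsetP[[a b] + ->]; rewrite !inE /= => /andP[/andP[Ra Rb] ab].
  rewrite /q /= [X in _ && X]groupM ?groupV ?(subsetP sRG) // andbT.
  by apply: contra ab => /RN -> //.
move=> y; have [-> | y1] := eqVneq y 1%g.
  by rewrite weight_enum1 oR inE group1 muln1 addn0.
rewrite muln0 add0n mul1n; have defW : weight_enum R y = #|[set u in D | y == q u]|.
  apply: eq_card => -[a b]; rewrite !inE /= /q /=.
  have [-> | ab] := eqVneq a b; last by rewrite andbT.
  by rewrite mulgV (negPf y1) !andbF.
rewrite defW -qD; have [/imsetP[u Du ->] | nqy] := boolP (y \in q @: D).
  rewrite /= -[RHS](cards1 u); apply: eq_card => v; rewrite in_set in_set1; apply/andP/eqP.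
    by case=> Dv /eqP/injq ->.
  by move=> ->.
apply/eqP; rewrite cards_eq0; apply/eqP/setP => u; rewrite in_set0 in_set.
by apply: contraNF nqy => /andP[Du /eqP ->]; apply: imset_f.
Qed.

(** The coordinates are abstract maps [e1] and [e2], so that both graphs [(x, f x)] and [(f x, x)]
    are instances. *)
Lemma planar_graph_rds (gT : finGroupType) (H : finZmodType) (N : {group gT})
    (e1 e2 : gT -> H) (r f : H -> H) (g : H -> gT) :
    {morph e1 : x y / (x * y)%g >-> x + y} ->
    {morph e2 : x y / (x * y)%g >-> x + y} ->
    (forall x y, e1 x = e1 y -> e2 x = e2 y -> x = y) ->
    (forall x, e1 (g x) = x) -> (forall x, e2 (g x) = f x) ->
    (forall x, (x \in N) = (e1 x == 0)) ->
    #|gT| = (#|H| * #|H|)%N -> #|N| = #|H| -> planar f ->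
  rel_diff_set [set: gT]%G N #|H| #|H| #|H| 1 [set g x | x : H].
Proof.
move=> e1M e2M e_inj e1g e2g defN ogT oN fP.
have mV (e : gT -> H) : {morph e : x y / (x * y)%g >-> x + y} ->
    forall x y, e (x * y^-1)%g = e x - e y.
  by move=> eM x y; have := eM (x * y^-1)%g y; rewrite mulgKV => ->; rewrite addrK.
apply: rdsI; rewrite ?subsetT ?cardsT //.
- by rewrite card_imset //; apply: can_inj e1g.
- move=> _ _ /imsetP[x _ ->] /imsetP[y _ ->].
  by rewrite defN mV // !e1g subr_eq0 => /eqP ->.
move=> _ _ _ _ /imsetP[a _ ->] /imsetP[b _ ->] /imsetP[c _ ->] /imsetP[d _ ->].
move=> ab E; have := congr1 e1 E; have := congr1 e2 E.
rewrite !mV // !e1g !e2g => E2 E1.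
have nz : a - b != 0 by rewrite subr_eq0; apply: contraNneq ab => ->.
(* The increments of [f] over the common nonzero step [a - b = c - d] agree at [b] and [d], so
   planarity gives [b = d]. *)
have /bij_inj := fP _ nz => /(_ b d) bd; rewrite -(subrK b a) -(subrK d c) -E1 bd //.
by rewrite /= subrKC E2 E1 subrKC.
Qed.

(** * Teichmueller sets *)

Section TeichmullerLift.

Variables (R : comNzRingType) (F : finFieldType) (red : R -> F) (m : nat).
Hypothesis m_gt0 : (0 < m)%N.
Hypothesis oF : #|F| = (2 ^ m)%N.
Hypothesis redD : {morph red : r s / r + s}.
Hypothesis redM : {morph red : r s / r * s}.
Hypothesis red1 : red 1 = 1.
Hypothesis red_surj : forall x, exists r, red r = x.
Hypothesis red_eq0 : forall r, red r = 0 -> exists s, r = s *+ 2.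
Hypothesis red_eq0E : forall r, (red r == 0) = (r *+ 2 == 0).
Hypothesis char4 : 4%:R = 0 :> R.

Implicit Types r s t : R.

Let redB : {morph red : r s / r - s}.
Proof.
by move=> r s; apply: (addIr (red s)); rewrite -redD !subrK.
Qed.

Let redX k : {morph red : r / r ^+ k}.
Proof. by move=> r; elim: k => // k IH; rewrite !exprS redM IH. Qed.

(** The kernel of [red] consists of doubles, and [(s + 2t)^2 = s^2 + 4(st + t^2)] with [4 = 0]. *)
Lemma sqr_red_eq r s : red r = red s -> r ^+ 2 = s ^+ 2.
Proof.
move/eqP; rewrite -subr_eq0 -redB => /eqP/red_eq0[t rst].
have -> : r = s + t *+ 2 by rewrite -rst subrKC.
have -> : (s + t *+ 2) ^+ 2 = s ^+ 2 + 4%:R * (s * t + t ^+ 2) by ring.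
by rewrite char4 mul0r addr0.
Qed.

Lemma expr2m_red_eq r s : red r = red s -> r ^+ (2 ^ m) = s ^+ (2 ^ m).
Proof.
by move/sqr_red_eq => E; rewrite -(prednK m_gt0) expnS !exprM E.
Qed.

Lemma red_inj_teich r s :
  r ^+ (2 ^ m) = r -> s ^+ (2 ^ m) = s -> red r = red s -> r = s.
Proof. by move=> rT sT /expr2m_red_eq; rewrite rT sT. Qed.

Lemma red_expr2m r : red (r ^+ (2 ^ m)) = red r.
Proof. by rewrite redX -oF expf_card. Qed.

(** A [2^m]-th power depends only on the residue and has the same residue as its base; so
    [r ^+ (2 ^ m)] is the required lift for any preimage [r] of [x]. *)
Lemma teich_lift (x : F) : exists2 r : R, r ^+ (2 ^ m) = r & red r = x.
Proof.
have [r <-] := red_surj x; exists (r ^+ (2 ^ m)); last exact: red_expr2m.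
by apply: expr2m_red_eq; apply: red_expr2m.
Qed.

(** The power [e = r ^+ (2 ^ m - 1)] has residue 1 and satisfies [e ^+ (2 ^ m) = e], so it equals
    [1 ^+ (2 ^ m)]. *)
Lemma teich_unit r : r ^+ (2 ^ m) = r -> r != 0 -> r ^+ (2 ^ m - 1) = 1.
Proof.
move=> rT r0; have red_r : red r != 0.
  apply: contraNneq r0 => red_r; rewrite -rT.
  have red0 : red 0 = 0 by apply/eqP; rewrite red_eq0E mul0rn.
  by rewrite (@expr2m_red_eq r 0) ?red0 // expr0n expn_eq0.
have q_gt0 : (0 < 2 ^ m)%N by rewrite expn_gt0.
have redE : red (r ^+ (2 ^ m - 1)) = 1.
  by apply: (mulfI red_r); rewrite -redM -exprS subn1 prednK // rT mulr1.
have eT : (r ^+ (2 ^ m - 1)) ^+ (2 ^ m) = r ^+ (2 ^ m - 1) by rewrite exprAC rT.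
by rewrite -eT (@expr2m_red_eq _ 1) ?expr1n // redE red1.
Qed.

(* Write x, y, z, w as squares of Teichmueller elements a, b, c, d.  Modulo 2,
   x + w = z + y gives a + d = c + b, so (a + d)^2 = (c + b)^2 holds exactly;
   subtracting, 2 a d = 2 c b, so {a, d} and {c, b} have the same sum and the
   same product in the residue field. *)
Lemma teich_diff_inj (x y z w : R) :
    x ^+ (2 ^ m) = x -> y ^+ (2 ^ m) = y ->
    z ^+ (2 ^ m) = z -> w ^+ (2 ^ m) = w ->
  x != y -> x - y = z - w -> x = z.
Proof.
(* Squaring is onto the Teichmueller elements: [r ^+ (2 ^ m.-1)] is a square root of [r]. *)
have sqrtT r : r ^+ (2 ^ m) = r ->
    exists2 s, s ^+ (2 ^ m) = s & r = s ^+ 2.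
  move=> rT; exists (r ^+ (2 ^ m.-1)); first by rewrite exprAC rT.
  by rewrite -exprM -expnSr prednK.
move=> /sqrtT[a aT ->] /sqrtT[b bT ->] /sqrtT[c cT ->] /sqrtT[d dT ->] ab E.
have {}E : a ^+ 2 + d ^+ 2 = c ^+ 2 + b ^+ 2.
  by apply/eqP; rewrite -subr_eq0 -(subrr (c ^+ 2 - d ^+ 2)) -{1}E; apply/eqP; ring.
have char2 : 2%:R = 0 :> F.
  have: red 2%:R == 0 by rewrite red_eq0E -mulrnA char4.
  by rewrite mulr2n redD red1 => /eqP.
have double0 (u : F) : u + u = 0 by rewrite -mulr2n -mulr_natl char2 mul0r.
have sum_eq : red a + red d = red c + red b.
  have sqrD (u v : F) : (u + v) ^+ 2 = u ^+ 2 + v ^+ 2.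
    by rewrite sqrrD -mulr_natl char2 mul0r addr0.
  have sq0 : (red a + red d - (red c + red b)) ^+ 2 = 0.
    rewrite sqrD sqrrN !sqrD -!redX -!redD E redD.
    exact: double0.
  by apply/eqP; rewrite -subr_eq0; move/eqP: sq0; rewrite expf_eq0.
have prod_eq : red a * red d = red c * red b.
  apply/eqP; rewrite -!redM -subr_eq0 -redB red_eq0E.
  have: (a + d) ^+ 2 = (c + b) ^+ 2 by apply: sqr_red_eq; rewrite !redD.
  move=> E2; apply/eqP; have -> : (a * d - c * b) *+ 2
    = ((a + d) ^+ 2 - (c + b) ^+ 2) - ((a ^+ 2 + d ^+ 2) - (c ^+ 2 + b ^+ 2)) by ring.
  by rewrite E E2 !subrr.
(* Equal sums and products make [red a] a root of the quadratic with roots [red c] and [red b]; the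
   root [red b] would give [a = b]. *)
have: (red a - red c) * (red a - red b) = 0.
  have -> : (red a - red c) * (red a - red b)
    = red a * ((red a + red d) - (red c + red b)) - (red a * red d - red c * red b).
    by ring.
  by rewrite sum_eq prod_eq !subrr mulr0 subr0.
move/eqP; rewrite mulf_eq0 !subr_eq0 => /orP[/eqP/red_inj_teich -> // | ].
by move/eqP/red_inj_teich => eab; rewrite eab ?eqxx in ab.
Qed.

End TeichmullerLift.

(** * The Galois ring, its residue field and its Teichmueller set *)

Section GaloisReduction.

Variables (m : nat) (f : {poly 'Z_4}).
Hypothesis galf : galois_poly m f.

Definition Z4_to_F2 (c : 'Z_4) : 'F_2 := (c : nat)%:R.

Lemma Z4_to_F2_additive : zmod_morphism Z4_to_F2.
Proof. by move=> x y; case: x => [[|[|[|[|x]]]] ?] //; case: y => [[|[|[|[|y]]]] ?] //;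
  apply: val_inj. Qed.

Lemma Z4_to_F2_monoid : monoid_morphism Z4_to_F2.
Proof.
split; first exact: val_inj.
by move=> x y; case: x => [[|[|[|[|x]]]] ?] //; case: y => [[|[|[|[|y]]]] ?] //;
  apply: val_inj.
Qed.

HB.instance Definition _ :=
  GRing.isZmodMorphism.Build 'Z_4 'F_2 Z4_to_F2 Z4_to_F2_additive.
HB.instance Definition _ :=
  GRing.isMonoidMorphism.Build 'Z_4 'F_2 Z4_to_F2 Z4_to_F2_monoid.

Definition F2_to_Z4 (c : 'F_2) : 'Z_4 := (c : nat)%:R.

Definition half_Z4 (c : 'Z_4) : 'Z_4 := ((c : nat)./2)%:R.

Lemma F2_to_Z4K : cancel F2_to_Z4 Z4_to_F2.
Proof. by move=> x; case: x => [[|[|x]] ?] //; apply: val_inj. Qed.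

Lemma Z4_to_F2_eq0 c : (Z4_to_F2 c == 0) = (c *+ 2 == 0).
Proof. by case: c => [[|[|[|[|c]]]] ?]. Qed.

Lemma half_Z4K c : Z4_to_F2 c = 0 -> half_Z4 c *+ 2 = c.
Proof.
by case: c => [[|[|[|[|c]]]] ?] // /(congr1 val) // _; apply: val_inj.
Qed.

Let fb := map_poly Z4_to_F2 f.

Let f_monic : f \is monic. Proof. by case: galf. Qed.

Let size_f : size f = m.+1. Proof. by case: galf. Qed.

Let fb_monic : fb \is monic. Proof. exact: monic_map. Qed.

Let size_fb : size fb = m.+1.
Proof. by rewrite size_map_poly_id0 // (monicP f_monic) rmorph1 oner_neq0. Qed.

Let fb_irr : monic_irreducible_poly fb.
Proof. by split=> //; case: galf. Qed.

Lemma galois_poly_gt0 : (0 < m)%N.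
Proof. by have [] := fb_irr.1; rewrite size_fb. Qed.

(** The quotient [{poly %/ f}] is taken modulo [mk_monic f], which is guaranteed to be [f] itself
    when [f] is monic and nonconstant. *)
Let mk_f : mk_monic f = f.
Proof. by rewrite /mk_monic f_monic size_f ltnS galois_poly_gt0. Qed.

Let mk_fb : mk_monic fb = fb.
Proof. exact: mk_monicE. Qed.

Let residue := {poly %/ fb with fb_irr}.

Let red (r : galois_ring f) : residue :=
  in_qpoly fb (map_poly Z4_to_F2 (polyn r)).

Let card_residue : #|residue| = (2 ^ m)%N.
Proof. by rewrite card_qfpoly size_fb card_Fp. Qed.

Let redD : {morph red : r s / r + s}.
Proof. by move=> r s; rewrite /red rmorphD in_qpolyD. Qed.

Let red1 : red 1 = 1.
Proof. by rewrite /red rmorph1 in_qpoly1. Qed.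

(** Coefficient reduction sends multiples of [f] to multiples of [fb]; this is what makes [red]
    multiplicative. *)
Let in_qpoly_rmodp (p : {poly 'Z_4}) :
  in_qpoly fb (map_poly Z4_to_F2 (Pdiv.Ring.rmodp p (mk_monic f)))
    = in_qpoly fb (map_poly Z4_to_F2 p).
Proof.
rewrite [in RHS](Pdiv.RingMonic.rdivp_eq f_monic p) mk_f.
rewrite rmorphD rmorphM /= in_qpolyD in_qpolyM -/fb.
have -> : in_qpoly fb fb = 0.
  by apply: val_inj; rewrite /= mk_fb Pdiv.RingMonic.rmodpp.
by rewrite mulr0 add0r.
Qed.

Let redM : {morph red : r s / r * s}.
Proof.
by move=> r s; rewrite /red -[RHS]in_qpolyM -rmorphM; apply: in_qpoly_rmodp.
Qed.

Let size_galois_ring (r : galois_ring f) : (size (polyn r) <= m)%N.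
Proof. by have := size_mk_monic r; rewrite [in X in (_ < X)%N]mk_f size_f. Qed.

(** Representatives have degree below [m], the degree of [fb], so no division takes place after the
    coefficients are reduced. *)
Let red_eq0P (r : galois_ring f) :
  red r = 0 <-> forall i, Z4_to_F2 (polyn r)`_i = 0.
Proof.
have -> : red r = 0 <-> map_poly Z4_to_F2 (polyn r) = 0.
  rewrite /red; split=> [/(congr1 val) | ->]; last exact: in_qpoly0.
  rewrite /= Pdiv.Ring.rmodp_small // mk_fb size_fb ltnS.
  exact: leq_trans (size_poly _ _) (size_galois_ring r).
split=> [/polyP E i | E]; first by have := E i; rewrite coef_map coef0.
by apply/polyP => i; rewrite coef_map coef0.
Qed.

Let galois_ring_of_coef (F : nat -> 'Z_4) :
  exists r : galois_ring f,
    forall i, (polyn r)`_i = if (i < m)%N then F i else 0.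
Proof.
exists (in_qpoly f (\poly_(i < m) F i)) => i.
by rewrite in_qpoly_small ?coef_poly // mk_f size_f ltnS size_poly.
Qed.

Let red_surj x : exists r, red r = x.
Proof.
have [r rE] := galois_ring_of_coef (fun i => F2_to_Z4 (polyn x)`_i).
exists r; rewrite /red; have -> : map_poly Z4_to_F2 (polyn r) = polyn x.
  apply/polyP => i; rewrite coef_map rE; case: ltnP => [_|mi].
    exact: F2_to_Z4K.
  rewrite [RHS]nth_default; first exact: rmorph0.
  apply: leq_trans mi; have := size_mk_monic x.
  by rewrite [in X in (_ < X)%N]mk_fb size_fb.
by apply: val_inj; apply: in_qpoly_small; apply: size_mk_monic.
Qed.

Let coef_double (r : galois_ring f) i : (polyn (r *+ 2))`_i = (polyn r)`_i *+ 2.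
Proof. by rewrite !mulr2n -coefD. Qed.

Let red_eq0 r : red r = 0 -> exists s, r = s *+ 2.
Proof.
move/red_eq0P => E; have [s sE] := galois_ring_of_coef (fun i => half_Z4 (polyn r)`_i).
exists s; apply: val_inj; apply/polyP => i.
rewrite [RHS]coef_double sE; case: ltnP => [_|mi].
  by rewrite half_Z4K.
by rewrite mul0rn nth_default // (leq_trans (size_galois_ring r)).
Qed.

Let red_eq0E r : (red r == 0) = (r *+ 2 == 0).
Proof.
apply/eqP/eqP => [/red_eq0P E | E].
  apply: val_inj; apply/polyP => i; rewrite [LHS]coef_double coef0.
  by apply/eqP; rewrite -Z4_to_F2_eq0 E.
by apply/red_eq0P => i; apply/eqP; rewrite Z4_to_F2_eq0 -coef_double E coef0.
Qed.

Let char4 : 4%:R = 0 :> galois_ring f.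
Proof.
apply: val_inj; apply/polyP => i; rewrite coef0 (mulrnA _ 2 2).
rewrite [LHS]coef_double coef_double.
by case: (polyn _)`_i => [[|[|[|[|c]]]] ?] //; apply: val_inj.
Qed.

(** One direction is Lagrange in [C]. For the other, the units with [u ^+ (2 ^ m - 1) = 1] form a
    group that [red] maps bijectively and multiplicatively onto the nonzero residues; it is
    therefore cyclic of order [2 ^ m - 1], and it contains every nonzero fixed point of the power
    map. *)
Lemma mem_teichmuller r : (r \in teichmuller m f) = (r ^+ (2 ^ m) == r).
Proof.
have m_gt0 := galois_poly_gt0; have q_gt0 : (0 < 2 ^ m)%N by rewrite expn_gt0.
apply/setU1P/eqP => [[->|/bigcupP[C /andP[_ /eqP oC] /imsetP[u Cu ->]]] | rT].
- by rewrite expr0n expn_eq0.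
- have : (u ^+ (2 ^ m - 1))%g = 1%g by rewrite -oC expg_cardG.
  move/(congr1 val); rewrite FinRing.val_unitX /= => E.
  by rewrite -{1}(subnK q_gt0) addn1 exprSr E mul1r.
have [-> | r0] := eqVneq r 0; [by left | right].
have tU (s : galois_ring f) : s ^+ (2 ^ m) = s -> s != 0 -> s ^+ (2 ^ m - 1) = 1.
  exact: (teich_unit m_gt0 redD redM red1 red_eq0 red_eq0E char4).
have unitP (s : galois_ring f) : s ^+ (2 ^ m) = s -> s != 0 -> s \is a GRing.unit.
  move=> sT s0; have q1 : (1 < 2 ^ m)%N by rewrite -{1}(expn0 2) ltn_exp2l.
  have E : (2 ^ m - 1 = (2 ^ m - 2).+1)%N by rewrite -subSn.
  by apply/unitrP; exists (s ^+ (2 ^ m - 2)); rewrite -exprSr -exprS -E tU.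
have red0 : red 0 = 0 by apply: (addrI (red 0)); rewrite -redD !addr0.
pose C := [set u : {unit galois_ring f} | u ^+ (2 ^ m - 1) == 1]%g.
have gC : group_set C.
  apply/group_setP; split=> [|u v]; rewrite !inE ?expg1n //.
  by move=> /eqP u1 /eqP v1; rewrite expgMn ?u1 ?v1 ?mulg1 //; apply: val_inj; apply: mulrC.
have CT u : u \in C -> (val u : galois_ring f) ^+ (2 ^ m) = val u.
  rewrite inE => /eqP/(congr1 val); rewrite FinRing.val_unitX /= => E.
  by rewrite -[X in _ ^+ X](subnK q_gt0) addn1 exprSr E mul1r.
have unitU (u : {unit galois_ring f}) :
    (val u : galois_ring f) \is a GRing.unit by exact: (valP u).
have memC (u : {unit galois_ring f}) :
    (val u : galois_ring f) ^+ (2 ^ m) = val u -> u \in C.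
  move=> uT; rewrite inE; apply/eqP/val_inj; rewrite FinRing.val_unitX /=.
  by apply: tU => //; apply: contraTneq (unitU u) => /= ->; rewrite unitr0.
have red_unit (u : {unit galois_ring f}) : red (val u) != 0.
  have := congr1 red (mulrV (unitU u)); rewrite redM red1 => /eqP E.
  by apply: contraTneq E => ->; rewrite mul0r eq_sym oner_eq0.
have injC : {in C &, injective (fun u : {unit galois_ring f} => red (val u))}.
  move=> u v /CT uT /CT vT E; apply: val_inj.
  exact: (red_inj_teich m_gt0 redD red_eq0 char4).
have oC : #|C| = (2 ^ m - 1)%N.
  rewrite -(card_in_imset injC) subn1 -card_residue -(cardsC1 (0 : residue)).
  apply: eq_card => x; rewrite !inE; apply/imsetP/idP => [[u _ ->] | x0] //.
  have [s sT sx] : exists2 s : galois_ring f, s ^+ (2 ^ m) = s & red s = x.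
    exact: (teich_lift m_gt0 card_residue redD redM red1 red_surj red_eq0 char4).
  have s0 : s != 0 by apply: contraNneq x0 => s0; rewrite -sx s0 red0.
  exists (FinRing.unit _ (unitP s sT s0)); last by rewrite -sx.
  by apply: memC; exact: sT.
apply/bigcupP; exists (Group gC).
  rewrite oC eqxx andbT.
  apply: (@field_mul_group_cyclic _ (Group gC) residue (fun u => red (val u))).
    by move=> u v _ _; rewrite /= redM.
  move=> u Cu; split=> [E | ->] //.
  apply: injC => //; first exact: (group1 (Group gC)).
  by rewrite [LHS]E -[LHS]red1.
apply/imsetP; exists (FinRing.unit _ (unitP r rT r0)) => //.
by apply: memC; exact: rT.
Qed.

Lemma card_teichmuller : #|teichmuller m f| = (2 ^ m)%N.
Proof.
have m_gt0 := galois_poly_gt0.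
rewrite -card_residue -(@card_in_imset _ _ red) => [|r s].
  rewrite -[RHS]cardsT; apply: eq_card => x; rewrite inE; apply/imsetP.
  have [s sT sx] : exists2 s : galois_ring f, s ^+ (2 ^ m) = s & red s = x.
    exact: (teich_lift m_gt0 card_residue redD redM red1 red_surj red_eq0 char4).
  by exists s; rewrite // mem_teichmuller sT.
rewrite !mem_teichmuller => /eqP rT /eqP sT.
exact: (red_inj_teich m_gt0 redD red_eq0 char4).
Qed.

(** Doubling kills exactly the kernel of [red], and [red] is injective on the Teichmueller set;
    hence no nonzero difference falls in the forbidden subgroup. *)
Lemma teichmuller_sub_twice :
  {in teichmuller m f &, forall r s, (r - s) *+ 2 = 0 -> r = s}.
Proof.
move=> r s; rewrite !mem_teichmuller => /eqP rT /eqP sT /eqP.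
rewrite -red_eq0E => /eqP E; have m_gt0 := galois_poly_gt0.
apply: (red_inj_teich m_gt0 redD red_eq0 char4) => //.
by rewrite -(subrK s r) redD E add0r.
Qed.

Lemma teichmuller_diff_inj (x y z w : galois_ring f) :
    x \in teichmuller m f -> y \in teichmuller m f ->
    z \in teichmuller m f -> w \in teichmuller m f ->
  x != y -> x - y = z - w -> x = z.
Proof.
rewrite !mem_teichmuller => /eqP xT /eqP yT /eqP zT /eqP wT.
have m_gt0 := galois_poly_gt0.
exact: (teich_diff_inj m_gt0 redD redM red1 red_eq0 red_eq0E char4).
Qed.

End GaloisReduction.

(** * Assembling primitive dual pairs, and the pairs in [Z_4^m] *)

Lemma rds_primitive_dual_pair (gT : finGroupType) (G : {group gT})
    (Delta : gT -> 'CF(G)) (N M S T : {set gT}) n :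
    abelian G -> dual_iso Delta ->
    rel_diff_set G N n n n 1 S -> rel_diff_set G M n n n 1 T ->
    annihilator Delta N = M -> annihilator Delta M = N ->
  primitive_dual_pair Delta S T.
Proof.
move=> abG dualD rdsS rdsT annN annM.
have [[gN sNG] _ _ _ _] := rdsS.
apply/(@rds_dual_iff _ G (Group gN) Delta n S T abG dualD sNG rdsS).
by rewrite /= annN annM.
Qed.

Lemma Z4_primitive_dual_pair m (S T : {set 'rV['Z_4]_m}) :
    rel_diff_set [set: 'rV['Z_4]_m]%G (twice_Z4 m)
      (2 ^ m) (2 ^ m) (2 ^ m) 1 S ->
    rel_diff_set [set: 'rV['Z_4]_m]%G (twice_Z4 m)
      (2 ^ m) (2 ^ m) (2 ^ m) 1 T ->
  primitive_dual_pair (G := [set: 'rV['Z_4]_m]%G) (@Z4_char m) S T.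
Proof.
move=> rdsS rdsT.
apply: (rds_primitive_dual_pair _ (Z4_char_dual_iso m) rdsS rdsT).
- exact: FinRing.zmod_abelian.
- exact: annihilator_twice_Z4.
- exact: annihilator_twice_Z4.
Qed.

Lemma group_set_twice_Z4 m : group_set (twice_Z4 m).
Proof.
apply/group_setP; split=> [|x y]; rewrite !twice_Z4E ?mul0rn //.
by move=> /eqP x2 /eqP y2; rewrite mulrnDl x2 y2 addr0.
Qed.

Lemma card_twice_Z4 m : #|twice_Z4 m| = (2 ^ m)%N.
Proof.
(* Doubling of lifts identifies [F_2^m] with [2 Z_4^m]. *)
pose g (x : 'rV['F_2]_m) : 'rV['Z_4]_m := map_mx (fun c => F2_to_Z4 c *+ 2) x.
have g_inj : injective g.
  move=> x y /matrixP E; apply/matrixP => i j; have := E i j; rewrite !mxE.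
  by case: (x i j) => [[|[|?]] ?] //; case: (y i j) => [[|[|?]] ?] // E';
    apply: val_inj; have := congr1 val E'.
have -> : twice_Z4 m = g @: setT.
  apply/setP => y; rewrite twice_Z4E; apply/eqP/imsetP => [y2 | [x _ ->]].
    exists (map_mx (fun c => Z4_to_F2 (half_Z4 c)) y) => //.
    apply/rowP => j; rewrite !mxE; move/rowP/(_ j): y2.
    rewrite -scaler_nat !mxE; case: (y 0 j) => [[|[|[|[|?]]]] ?] // E';
      by [apply: val_inj | have := congr1 val E'].
  apply/rowP => j; rewrite -scaler_nat !mxE.
  by case: (x 0 j) => [[|[|?]] ?] //; apply: val_inj.
by rewrite card_imset // cardsT card_mx card_Fp // mul1n.
Qed.

(** An additive bijection carries the kernel of doubling to the kernel of doubling, which in [Z_4^m]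
    is [twice_Z4 m]; so the difference properties transfer from the Galois ring along any [phi]. *)
Lemma teichmuller_rds m (f : {poly 'Z_4})
    (phi : {additive galois_ring f -> 'rV['Z_4]_m}) :
    galois_poly m f -> bijective phi ->
  rel_diff_set [set: 'rV['Z_4]_m]%G (twice_Z4 m) (2 ^ m) (2 ^ m) (2 ^ m) 1
    (phi @: teichmuller m f).
Proof.
move=> galf /bij_inj phi_inj.
have diffE (a b : 'rV['Z_4]_m) : (a * b^-1)%g = a - b by [].
apply: (rdsI (N := Group (group_set_twice_Z4 m))); rewrite ?subsetT //=.
- by rewrite cardsT card_mx card_ord mul1n -expnMn.
- exact: card_twice_Z4.
- by rewrite card_imset // (card_teichmuller galf).
- move=> _ _ /imsetP[r Tr ->] /imsetP[s Ts ->].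
  rewrite diffE twice_Z4E -raddfB -raddfMn /= raddf_eq0 // => /eqP E.
  by congr (phi _); apply: (teichmuller_sub_twice galf).
move=> _ _ _ _ /imsetP[x Tx ->] /imsetP[y Ty ->] /imsetP[z Tz ->] /imsetP[w Tw ->].
rewrite !diffE -!raddfB (inj_eq phi_inj) => xy /phi_inj E; congr (phi _).
exact: (teichmuller_diff_inj galf Tx Ty Tz Tw).
Qed.

(** * Pairs of graphs of planar functions *)

Section PlanarPairs.

Variables (p m : nat) (zeta : algC).
Hypotheses (p_pr : prime p) (zetaP : p.-primitive_root zeta).

Let H := 'rV['F_p]_m.
(** [N1] is the forbidden subgroup for the graph [(x, f1 x)] and [N2] the one for [(f2 x, x)]; the
    pairing makes each the annihilator of the other. *)
Let N1 : {set H * H} := [set u | u.1 == 0].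
Let N2 : {set H * H} := [set u | u.2 == 0].

Let gN1 : group_set N1.
Proof.
apply/group_setP; split=> [|u v]; rewrite !inE //.
move=> /eqP u0 /eqP v0; apply/eqP; transitivity (u.1 + v.1) => //.
by rewrite u0 v0 addr0.
Qed.

Let gN2 : group_set N2.
Proof.
apply/group_setP; split=> [|u v]; rewrite !inE //.
move=> /eqP u0 /eqP v0; apply/eqP; transitivity (u.2 + v.2) => //.
by rewrite u0 v0 addr0.
Qed.

Let Fp_char_eq1 (y a : H * H) :
  (Fp_char zeta y a == 1) = (dot y.1 a.1 + dot y.2 a.2 == 0).
Proof.
move: zetaP; rewrite -{1}(Fp_cast p_pr) => zP.
apply: (pairing_eq1 (B := fun y a : H * H => dot y.1 a.1 + dot y.2 a.2) zP).
by move=> {}y {}a; rewrite abelian_cfunE.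
Qed.

Let annN1 : annihilator (G := [set: H * H]%G) (@Fp_char p m zeta) N1 = N2.
Proof.
apply/setP => y; rewrite !inE /=; apply/forall_inP/eqP => [y1 | y2 a].
  apply: dot_inj => a; have := y1 (0, a); rewrite inE eqxx Fp_char_eq1 /=.
  by rewrite dot0r dot0l add0r => /(_ isT)/eqP.
by rewrite inE Fp_char_eq1 y2 dot0l addr0 => /eqP ->; rewrite dot0r.
Qed.

Let annN2 : annihilator (G := [set: H * H]%G) (@Fp_char p m zeta) N2 = N1.
Proof.
apply/setP => y; rewrite !inE /=; apply/forall_inP/eqP => [y1 | y2 a].
  apply: dot_inj => a; have := y1 (a, 0); rewrite inE eqxx Fp_char_eq1 /=.
  by rewrite dot0r dot0l addr0 => /(_ isT)/eqP.
by rewrite inE Fp_char_eq1 y2 dot0l add0r => /eqP ->; rewrite dot0r.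
Qed.

Lemma planar_primitive_dual_pair (f1 f2 : H -> H) :
    planar f1 -> planar f2 ->
  primitive_dual_pair (G := [set: H * H]%G) (@Fp_char p m zeta)
    [set (x, f1 x) | x : H] [set (f2 x, x) | x : H].
Proof.
move=> planar1 planar2.
have oN1 : #|N1| = #|H|.
  rewrite -(card_imset (mem H) (f := fun x : H => (0 : H, x))) => [|x y [] //].
  apply: eq_card => -[a b]; rewrite inE; apply/eqP/imsetP => /= [-> | [x _ [-> _]]] //.
  by exists b.
have oN2 : #|N2| = #|H|.
  rewrite -(card_imset (mem H) (f := fun x : H => (x, 0 : H))) => [|x y [] //].
  apply: eq_card => -[a b]; rewrite inE; apply/eqP/imsetP => /= [-> | [x _ [_ ->]]] //.
  by exists a.
apply: (rds_primitive_dual_pair (N := N1) (M := N2) (n := #|H|)) annN1 annN2.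
- exact: Fp_pair_abelian.
- exact: Fp_char_dual_iso.
- apply: (planar_graph_rds (N := Group gN1) (e1 := fst) (e2 := snd)) => //=.
  + by move=> [? ?] [? ?] /= -> ->.
  + by move=> x; rewrite inE.
  + by rewrite card_prod.
- apply: (planar_graph_rds (N := Group gN2) (e1 := snd) (e2 := fst)) => //=.
  + by move=> [? ?] [? ?] /= -> ->.
  + by move=> x; rewrite inE.
  + by rewrite card_prod.
Qed.

End PlanarPairs.

Theorem theorem3p7 :
  (forall (gT : finGroupType) (G N : {group gT}) (Delta : gT -> 'CF(G))
          (n : nat) (S : {set gT}),
     abelian G -> dual_iso Delta -> N \subset G ->
     rel_diff_set G N n n n 1 S ->
     (forall T : {set gT}, T \subset G ->
        (primitive_dual_pair Delta S T <->
         rel_diff_set G (annihilator Delta N) n n n 1 T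
         /\ annihilator Delta (annihilator Delta N) = N))
     /\ ({in G &, forall x y, Delta x y = Delta y x} ->
         forall T : {set gT}, T \subset G ->
           (primitive_dual_pair Delta S T <->
            rel_diff_set G (annihilator Delta N) n n n 1 T)))
  /\ (forall m : nat, (0 < m)%N ->
      [/\ dual_iso (G := [set: 'rV['Z_4]_m]%G) (@Z4_char m),
          forall S T : {set 'rV['Z_4]_m},
            rel_diff_set [set: 'rV['Z_4]_m]%G (twice_Z4 m)
              (2 ^ m) (2 ^ m) (2 ^ m) 1 S ->
            rel_diff_set [set: 'rV['Z_4]_m]%G (twice_Z4 m)
              (2 ^ m) (2 ^ m) (2 ^ m) 1 T ->
            primitive_dual_pair (G := [set: 'rV['Z_4]_m]%G) (@Z4_char m) S T
        & forall (f : {poly 'Z_4}),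
            galois_poly m f ->
            forall phi : {additive galois_ring f -> 'rV['Z_4]_m},
              bijective phi ->
              primitive_dual_pair (G := [set: 'rV['Z_4]_m]%G) (@Z4_char m)
                (phi @: teichmuller m f) (phi @: teichmuller m f)])
  /\ (forall (p m : nat) (zeta : algC),
        prime p -> odd p -> p.-primitive_root zeta ->
        dual_iso (G := [set: 'rV['F_p]_m * 'rV['F_p]_m]%G) (@Fp_char p m zeta)
        /\ forall f1 f2 : 'rV['F_p]_m -> 'rV['F_p]_m,
             planar f1 -> planar f2 ->
             primitive_dual_pair (G := [set: 'rV['F_p]_m * 'rV['F_p]_m]%G)
               (@Fp_char p m zeta)
               [set (x, f1 x) | x : 'rV['F_p]_m]
               [set (f2 x, x) | x : 'rV['F_p]_m]).
Proof.
split=> [gT G N Delta n S abG dualD sNG rdsS | ].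
  split=> [T _ | symD T _]; first exact: rds_dual_iff.
  split=> [/(rds_dual_iff _ abG dualD sNG rdsS)[] // | rdsT].
  apply/(rds_dual_iff _ abG dualD sNG rdsS); split=> //.
  exact: annihilatorK_sym.
split=> [m _ | p m zeta p_pr _ zetaP].
  split=> [|S T|f galf phi phi_bij].
  - exact: Z4_char_dual_iso.
  - exact: Z4_primitive_dual_pair.
  by apply: Z4_primitive_dual_pair; apply: teichmuller_rds.
split=> [|f1 f2]; first exact: Fp_char_dual_iso.
exact: planar_primitive_dual_pair.
Qed.
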